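(* Let $K$ be a compact metric space, $\Phi=\{\varphi_1,\dots,\varphi_n\}$ a system of linearly independent real-valued functions in $C(K)$, and $\mathcal{P}$ the space of polynomials by the system $\Phi$. For every $f\in C(K)$, all polynomials of best approximation for $f$ have the same generalized alternance with the same values on it. That is, there exist points $\tau_1,\dots,\tau_m\in K$ such that $\{\tau_i\}_{i=1}^m$ is a generalized alternance of every polynomial of best approximation $p\in\mathcal{P}$ for $f$, and, for each $i=1,\dots,m$, the value $p(\tau_i)$ is the same for all polynomials $p$ of best approximation for $f$.
   Context: $C(K)$ is the space of continuous real functions on $K$ with the uniform norm $\|g\|=\max_{t\in K}|g(t)|$. A polynomial by the system $\Phi$ is a linear combination $p=\sum_{k=1}^n p^k\varphi_k$ with $p^k\in\mathbb{R}$; $\mathcal{P}$ is the linear space of all of them. A polynomial $p\in\mathcal{P}$ is of best approximation for $f$ if $\|p-f\|\le\|q-f\|$ for all $q\in\mathcal{P}$. The moment vector of $t\in K$ is $\boldsymbol{u}(t)=(\varphi_1(t),\dots,\varphi_n(t))^T\in\mathbb{R}^n$. Generalized alternance: given $f$, a polynomial $p\in\mathcal{P}$ has a generalized alternance $\{\tau_1,\dots,\tau_m\}$, where $\tau_i\in K$ and $1\le m\le n+1$, if there are signs $\sigma_1,\dots,\sigma_m\in\{-1,1\}$ such that (1) $p(\tau_i)-f(\tau_i)=\sigma_i\|p-f\|$ for all $i=1,\dots,m$; and (2) the convex hull of the vectors $\{\sigma_i\boldsymbol{u}(\tau_i)\}_{i=1}^m$ in $\mathbb{R}^n$ contains the origin.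 The points are given as an indexed list; they are not required to be distinct. *)

(* Defs.v *)
From mathcomp Require Import all_boot all_order all_algebra.
From mathcomp Require Import all_classical all_reals all_analysis.

Set Implicit Arguments.
Unset Strict Implicit.
Unset Printing Implicit Defensive.

Import Order.TTheory GRing.Theory Num.Theory.
Import numFieldNormedType.Exports.

Local Open Scope classical_set_scope.
Local Open Scope ring_scope.

(* Elements of C(K) are functions [K -> R] that are assumed [continuous];
   the system Phi is a family [phi : 'I_n -> K -> R]. *)

(* The supremum is a maximum when K is compact and nonempty and g is
   continuous, see [uniform_norm_max]. *)
Definition uniform_norm (R : realType) (K : Type) (g : K -> R) : R :=
  sup (range (fun t => `|g t|)).

Definition lin_comb (R : realType) (K : Type) (n : nat)
    (phi : 'I_n -> K -> R) (c : 'I_n -> R) : K -> R :=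
  fun t => \sum_(k < n) c k * phi k t.

Definition linearly_independent (R : realType) (K : Type) (n : nat)
    (phi : 'I_n -> K -> R) : Prop :=
  forall c : 'I_n -> R,
    (forall t, lin_comb phi c t = 0) -> forall k, c k = 0.

Definition polynomials (R : realType) (K : Type) (n : nat)
    (phi : 'I_n -> K -> R) : set (K -> R) :=
  range (lin_comb phi).

Definition best_approximation (R : realType) (K : Type) (n : nat)
    (phi : 'I_n -> K -> R) (f p : K -> R) : Prop :=
  polynomials phi p /\
  forall q, polynomials phi q ->
    uniform_norm (p \- f) <= uniform_norm (q \- f).

Definition moment_vector (R : realType) (K : Type) (n : nat)
    (phi : 'I_n -> K -> R) (t : K) : 'cV[R]_n :=
  \col_(k < n) phi k t.

Definition convex_hull (R : realType) (M : lmodType R)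
    (A : set (convex_lmodType M)) : set (convex_lmodType M) :=
  smallest (@convex_set R M) A.

(* [tau] is an indexed list of points, with repetitions allowed. *)
Definition generalized_alternance (R : realType) (K : Type) (n : nat)
    (phi : 'I_n -> K -> R) (f p : K -> R) (m : nat) (tau : 'I_m -> K) : Prop :=
  (1 <= m <= n.+1)%N /\
  exists sigma : 'I_m -> R,
    [/\ forall i, sigma i = -1 \/ sigma i = 1,
        forall i, p (tau i) - f (tau i) = sigma i * uniform_norm (p \- f)
      & convex_hull (range (fun i => sigma i *: moment_vector phi (tau i))) 0].

Lemma uniform_norm_max (R : realType) (K : topologicalType) (g : K -> R) :
  compact [set: K] -> [set: K] !=set0 -> continuous g ->
  exists2 t, uniform_norm g = `|g t| & forall s, `|g s| <= `|g t|.
Proof.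
move=> cK [t0 _] cg.
set A := range (fun t => `|g t|).
have cA : compact A.
  apply: continuous_compact => //; apply: continuous_subspaceT => t.
  by apply: cvg_norm; exact: cg.
have A0 : A !=set0 by exists `|g t0|, t0.
have supA : has_sup A by apply: compact_has_sup.
have clA : closed A by apply: compact_closed => //; exact: norm_hausdorff.
have [t _ tE] : A (sup A).
  by rewrite [X in X _]((closure_id A).1 clA); exact: closure_sup A0 supA.2.
exists t; rewrite ?/uniform_norm -/A -?tE// => s.
by rewrite tE; apply: ub_le_sup; [exact: supA.2|exists s].
Qed.

(* Main.v *)
Require Import Defs.
From mathcomp Require Import all_boot all_order all_algebra.
From mathcomp Require Import all_classical all_reals all_analysis.
From mathcomp Require Import ring lra.

Set Implicit Arguments.
Unset Strict Implicit.
Unset Printing Implicit Defensive.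

Import Order.TTheory GRing.Theory Num.Theory.
Import numFieldNormedType.Exports.

Local Open Scope classical_set_scope.
Local Open Scope ring_scope.

(** Write [u t] for the moment vector of [t] and let E be the distance from f to
    the polynomials, so that E = ||p - f|| for every best approximation p.

    A single best approximation p has an alternance by a convexity argument in
    R^n. Consider the compact set X of the signed extremal points of p, the pairs
    (t, s) with s = 1 or s = -1 and p t - f t = s E. By [separation], either 0 is
    a convex combination of n + 1 vectors s *: u t with (t, s) in X, which is an
    alternance, or there is a polynomial g with s * g t > 0 on X. In the second
    case [kolmogorov_descent] gives an e with |p - e g - f| < E everywhere, which
    contradicts the choice of p. This is [alternance_points].

    To serve all best approximations at once, the argument is run on one with as
    few extremal points as possible, as measured by the span of their moment
    vectors. Such a p satisfies q t = p t at each of its extremal points t, for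
    every best approximation q ([generic_best_approximation]): the midpoint of p
    and q is again a best approximation, and by the triangle inequality its
    extremal points are those of p at which q = p. Hence the alternance of p, with
    the same signs, is an alternance of every q, and all of them agree on it. *)

(** * Convex combinations *)

Lemma convex_hull_sum (R : realType) (M : lmodType R) (A : set (convex_lmodType M))
    (m : nat) (a : 'I_m -> M) (w : 'I_m -> R) :
  (forall i, A (a i)) -> (forall i, 0 <= w i) -> \sum_i w i = 1 ->
  convex_hull A (\sum_i w i *: a i).
Proof.
move=> Aa w0 w1 C [/= convC AC].
elim: m a w Aa w0 w1 => [|m IHm] a w Aa w0 w1.
  by move: w1; rewrite big_ord0 => /eqP; rewrite eq_sym oner_eq0.
rewrite big_ord_recl /= in w1; rewrite big_ord_recl /=.
set r := \sum_(i < m) w (lift ord0 i) in w1.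
have r_ge0 : 0 <= r by apply: sumr_ge0.
have [r0|r_neq0] := eqVneq r 0.
  rewrite big1 ?addr0; last first.
    move=> i _; rewrite (psumr_eq0P _ r0) ?scale0r// => j _; exact: w0.
  by rewrite r0 addr0 in w1; rewrite w1 scale1r; apply: AC; exact: Aa.
pose b := \sum_(i < m) (w (lift ord0 i) / r) *: a (lift ord0 i).
have Cb : C b.
  apply: (IHm (fun i => a (lift ord0 i)) (fun i => w (lift ord0 i) / r)).
  - by move=> i; exact: Aa.
  - by move=> i; rewrite divr_ge0.
  - by rewrite -mulr_suml divff.
have lamP : Itv.spec (@Itv.num_sem R) (Itv.Real `[0, 1]%Z) (w ord0).
  rewrite /= /Itv.num_sem num_real /= in_itv /= w0 /=; lra.
have := @convC (a ord0) b (Itv.mk lamP) (mem_set (AC _ (Aa ord0))) (mem_set Cb).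
move=> /set_mem; congr C.
rewrite /conv /=; have -> : unstable.onem (w ord0) = r by rewrite /unstable.onem; lra.
congr (_ + _).
rewrite scaler_sumr; apply: eq_bigr => i _.
by rewrite scalerA mulrC divfK.
Qed.

(** More than n + 1 points of R^n are affinely dependent; subtracting from the
    weights the largest admissible multiple of a dependency keeps them
    nonnegative and makes one of them vanish. *)
Lemma caratheodory (R : realFieldType) (n m : nat) (a : 'I_m -> 'cV[R]_n)
    (w : 'I_m -> R) :
  (n.+1 < m)%N -> (forall i, 0 <= w i) -> \sum_i w i = 1 ->
  exists j w', [/\ forall i, 0 <= w' i, w' j = 0, \sum_i w' i = 1
    & \sum_i w' i *: a i = \sum_i w i *: a i].
Proof.
move=> nm w0 w1.
have [mu [mu_neq0 mu_sum mu_a]] : exists mu : 'rV[R]_m,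
    [/\ mu != 0, \sum_i mu 0 i = 0 & \sum_i mu 0 i *: a i = 0].
  (* The last column of ones makes a linear dependency of the rows affine. *)
  pose A : 'M[R]_(m, n + 1) := \matrix_i row_mx (a i)^T 1.
  have : kermx A != 0.
    rewrite kermx_eq0 /row_free neq_ltn; apply/orP; left.
    by rewrite (leq_ltn_trans (rank_leq_col A))// addn1.
  move=> /rowV0Pn [mu /sub_kermxP muA mu_neq0]; exists mu; split => //.
    have /rowP /(_ (rshift n 0)) := muA.
    rewrite !mxE => muA_n; rewrite -[RHS]muA_n; apply: eq_bigr => i _.
    by rewrite mxE row_mxEr mxE mulr1.
  apply/colP => k; have /rowP /(_ (lshift 1 k)) := muA.
  rewrite !mxE summxE => muA_k; rewrite -[RHS]muA_k; apply: eq_bigr => i _.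
  by rewrite mxE [A i _]mxE row_mxEl mxE.
have [i0 mu_i0] : exists i, 0 < mu 0 i.
  apply: contrapT => /forallNP mu_le0.
  move: mu_neq0; apply/negP; rewrite negbK; apply/eqP/rowP => i; rewrite mxE.
  apply: oppr_inj; rewrite oppr0.
  apply: (@psumr_eq0P _ _ predT (fun i => - mu 0 i)) => //.
    by move=> j _; rewrite oppr_ge0 leNgt; apply/negP.
  by rewrite sumrN mu_sum oppr0.
case: (@arg_minP _ _ _ i0 (fun i => 0 < mu 0 i) (fun i => w i / mu 0 i)) => //.
move=> j mu_j j_min; pose s := w j / mu 0 j.
have s_ge0 : 0 <= s by rewrite divr_ge0// ltW.
exists j, (fun i => w i - s * mu 0 i); split.
- move=> i; rewrite subr_ge0; have [mu_i|mu_i] := ltP 0 (mu 0 i).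
    by rewrite -ler_pdivlMr// j_min.
  by rewrite (le_trans _ (w0 i))// mulr_ge0_le0.
- by rewrite divfK ?gt_eqF// subrr.
- by rewrite sumrB -mulr_sumr mu_sum mulr0 subr0.
- under eq_bigr do rewrite scalerBl -scalerA.
  by rewrite sumrB -scaler_sumr mu_a scaler0 subr0.
Qed.

(** * Continuity of sums, closedness of level sets *)

Lemma continuous_sum (R : realType) (T : topologicalType) (I : Type) (s : seq I)
    (F : I -> T -> R) :
  (forall i, continuous (F i)) -> continuous (fun x => \sum_(i <- s) F i x).
Proof.
move=> cF; apply: continuous_big => [|i _]; last exact: cF.
exact: add_continuous.
Qed.

Lemma closed_level_set (R : realType) (T : topologicalType) (F : T -> R) (c : R) :
  continuous F -> closed [set x | F x = c].
Proof.
move=> cF; apply: (@preimage_closed _ _ F [set c]) => [x _|]; first exact: cF.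
exact: closed_eq.
Qed.

(** * Separation of the origin from a compact set *)

Section Dot.
Context {R : realType} {n : nat}.
Implicit Types u v d : 'cV[R]_n.

Definition dot u v : R := \sum_k u k 0 * v k 0.

Lemma dot_line s u d :
  dot (u + s *: d) (u + s *: d) = dot u u + s * (2 * dot u d + s * dot d d).
Proof.
rewrite /dot !mulr_sumr -!big_split/= mulr_sumr -big_split/=.
by apply: eq_bigr => k _; rewrite !mxE; ring.
Qed.

Lemma dotDr u v d : dot u (v + d) = dot u v + dot u d.
Proof. by rewrite -big_split/=; apply: eq_bigr => k _; rewrite mxE mulrDr. Qed.

Lemma dot_ge0 u : 0 <= dot u u.
Proof. by apply: sumr_ge0 => k _; rewrite -expr2 sqr_ge0. Qed.

Lemma dot_gt0 u : u != 0 -> 0 < dot u u.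
Proof.
move=> u_neq0; rewrite lt_neqAle dot_ge0 andbT eq_sym.
apply: contra_neq u_neq0 => uu0; apply/colP => k; rewrite mxE; apply/eqP.
rewrite -sqrf_eq0 expr2; apply/eqP.
by apply: (psumr_eq0P _ uu0) => // j _; rewrite -expr2 sqr_ge0.
Qed.

End Dot.

(** The derivative at 0 of s |-> 2 a s + b s^2 is nonnegative when 0 minimises
    this function on the unit interval. *)
Lemma slope_ge0 (R : realFieldType) (a b : R) :
  0 <= b -> (forall s, 0 < s <= 1 -> 0 <= s * (2 * a + s * b)) -> 0 <= a.
Proof.
move=> b0 H; rewrite leNgt; apply/negP => a0.
have ba : 0 < b - a by lra.
pose s := - a / (b - a).
have s0 : 0 < s by rewrite divr_gt0// oppr_gt0.
have s1 : s <= 1 by rewrite ler_pdivrMr//; lra.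
have := H s; rewrite s0 s1 => /(_ isT).
rewrite pmulr_rge0// => H1.
have : s * (b - a) = - a by rewrite divfK// gt_eqF.
nra.
Qed.

(** The convex combinations of n + 1 vectors of [h @` X] are parametrised by a
    compact set, so one of them, v, has least Euclidean norm. If v is not 0, it
    separates: for y in X the segment from v to h y consists of combinations of
    n + 2 vectors, hence by [caratheodory] of n + 1 vectors, so the norm does not
    decrease at v in the direction of h y - v. *)
Lemma separation (R : realType) (T : topologicalType) (X : set T) (n : nat)
    (h : T -> 'cV[R]_n) :
  compact X -> X !=set0 -> (forall k, continuous (fun x => h x k 0)) ->
  (exists (x : 'I_n.+1 -> T) (w : 'I_n.+1 -> R),
     [/\ forall i, X (x i), forall i, 0 <= w i, \sum_i w i = 1
       & \sum_i w i *: h (x i) = 0]) \/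
  (exists c, forall x, X x -> 0 < dot c (h x)).
Proof.
move=> cX [x0 Xx0] ch.
pose Z := prod_topology (fun _ : 'I_n.+1 => (R * T)%type).
pose S : set Z := [set z | forall i, (`[0, 1] `*` X) (z i)]
  `&` [set z | \sum_i (z i).1 = 1].
pose v (z : Z) : 'cV[R]_n := \sum_i (z i).1 *: h (z i).2.
have c1 i : continuous (fun z : Z => (z i).1).
  move=> z; apply: (@continuous_comp _ _ _ (fun z : Z => z i) fst).
    exact: (@proj_continuous _ (fun _ : 'I_n.+1 => (R * T)%type) i).
  exact: cvg_fst.
have c2 i : continuous (fun z : Z => (z i).2).
  move=> z; apply: (@continuous_comp _ _ _ (fun z : Z => z i) snd).
    exact: (@proj_continuous _ (fun _ : 'I_n.+1 => (R * T)%type) i).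
  exact: cvg_snd.
have cv : continuous (fun z => dot (v z) (v z)).
  have cvk k : continuous (fun z => v z k 0).
    have -> : (fun z => v z k 0) = (fun z => \sum_i (z i).1 * h (z i).2 k 0).
      by apply/funext => z; rewrite summxE; apply: eq_bigr => i _; rewrite mxE.
    apply: continuous_sum => i z; apply: (cvgM (c1 i z)).
    apply: (@continuous_comp _ _ _ (fun z : Z => (z i).2) (fun x => h x k 0)).
      exact: c2.
    exact: ch.
  by apply: continuous_sum => k z; exact: (cvgM (cvk k z) (cvk k z)).
have cS : compact S.
  apply: compact_closedI.
    apply: (@tychonoff _ (fun=> (R * T)%type) (fun=> `[0, 1] `*` X)) => i.
    apply: compact_setX => //; exact: segment_compact.
  by apply: closed_level_set; apply: continuous_sum.
have S0 : S !=set0.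
  exists (fun i => (if i == ord0 then 1 else 0, x0)); split => /=.
    by move=> i; split => //=; rewrite in_itv/=; case: ifP; rewrite ?lexx ?ler01.
  by rewrite -big_mkcond/= big_pred1_eq.
have [z /set_mem [zX z1] zmin] := compact_EVT_min S0 cS (continuous_subspaceT cv).
have z0 i : 0 <= (z i).1 by case: (zX i) => /=; rewrite in_itv/= => /andP[].
have [vz0|vz_neq0] := eqVneq (v z) 0.
  by left; exists (fun i => (z i).2), (fun i => (z i).1); split => // i; case: (zX i).
right; exists (v z) => y Xy.
have -> : h y = v z + (h y - v z) by rewrite addrC subrK.
rewrite dotDr ltr_pwDl ?dot_gt0//.
apply: (slope_ge0 (dot_ge0 (h y - v z))) => s /andP[s0 s1].
rewrite -(lerD2l (dot (v z) (v z))) addr0 -dot_line.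
(* The point at s on the segment, with y as the extra vector of index 0. *)
pose x (i : 'I_n.+2) := if unlift ord0 i is Some j then (z j).2 else y.
pose w (i : 'I_n.+2) := if unlift ord0 i is Some j then (1 - s) * (z j).1 else s.
have Xx i : X (x i) by rewrite /x; case: unliftP => // j _; case: (zX j).
have w_ge0 i : 0 <= w i.
  by rewrite /w; case: unliftP => [j _|_]; [rewrite mulr_ge0// subr_ge0|exact: ltW].
have w1 : \sum_i w i = 1.
  rewrite big_ord_recl /w unlift_none; under eq_bigr do rewrite liftK.
  by rewrite -mulr_sumr z1; ring.
have wE : \sum_i w i *: h (x i) = v z + s *: (h y - v z).
  rewrite big_ord_recl /w /x unlift_none.
  under eq_bigr do rewrite liftK -scalerA.
  by rewrite -scaler_sumr -/(v z) scalerBl scale1r scalerBr addrC addrA addrAC.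
have [j [w' [w'0 w'j w'1 w'E]]] := caratheodory (fun i => h (x i)) (ltnSn _) w_ge0 w1.
pose z' : Z := fun i => (w' (lift j i), x (lift j i)).
have -> : v z + s *: (h y - v z) = v z'.
  by rewrite -wE -w'E (bigD1_ord j)//= w'j scale0r add0r.
have z'1 : \sum_i (z' i).1 = 1 by rewrite -w'1 [RHS](bigD1_ord j)//= w'j add0r.
apply: zmin; apply/mem_set; split => // i; split => //=.
by rewrite in_itv/= w'0/= -z'1 (bigD1 i)//= lerDl sumr_ge0.
Qed.

(** * Alternance of a best approximation *)

Section Approximation.
Context {R : realType} {K : topologicalType}.
Hypothesis K_compact : compact [set: K].
Hypothesis K_nonempty : [set: K] !=set0.

Lemma le_uniform_norm (g : K -> R) (t : K) :
  continuous g -> `|g t| <= uniform_norm g.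
Proof.
by move=> cg; have [s -> gs] := uniform_norm_max K_compact K_nonempty cg; exact: gs.
Qed.

Lemma uniform_norm_le (g : K -> R) (M : R) :
  continuous g -> (forall t, `|g t| <= M) -> uniform_norm g <= M.
Proof.
by move=> cg gM; have [s -> _] := uniform_norm_max K_compact K_nonempty cg; exact: gM.
Qed.

(** The residual r can be decreased uniformly in the direction g as soon as g
    has the sign of r wherever |r| = E. At each t some step e works; by
    convexity of |.| and since |r| <= E, every smaller positive step works as
    well, near t. Compactness of K then yields a common step. When E = 0 both
    signs s are admissible at every point, so the hypothesis on g is
    contradictory. *)
Lemma kolmogorov_descent (r g : K -> R) (E : R) :
  continuous r -> continuous g -> (forall t, `|r t| <= E) ->
  (forall t s, s * s = 1 -> r t = s * E -> 0 < s * g t) ->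
  exists e, forall t, `|r t - e * g t| < E.
Proof.
move=> cr cg rE gpos.
have pointwise t : exists2 e, 0 < e & `|r t - e * g t| < E.
  have [rltE|rgeE] := ltP `|r t| E.
    have g1 : 0 < 1 + `|g t| by rewrite ltr_pwDl.
    exists ((E - `|r t|) / (1 + `|g t|)); first by rewrite divr_gt0// subr_gt0.
    set e := _ / _; have e0 : 0 < e by rewrite divr_gt0// subr_gt0.
    rewrite (le_lt_trans (ler_normB _ _))// normrM (gtr0_norm e0).
    have : e * (1 + `|g t|) = E - `|r t| by rewrite divfK// gt_eqF.
    lra.
  have rtE : `|r t| = E by apply/eqP; rewrite eq_le rE rgeE.
  have [s ss rs] : exists2 s, s * s = 1 & r t = s * E.
    have [r0|r0] := leP 0 (r t).
      by exists 1; rewrite ?mulr1// mul1r -rtE ger0_norm.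
    by exists (-1); rewrite ?mulrNN ?mulr1// mulN1r -rtE ltr0_norm ?opprK.
  have sg := gpos _ _ ss rs.
  have E0 : 0 < E.
    rewrite lt_neqAle -{2}rtE normr_ge0 andbT; apply/eqP => E0.
    have := gpos t (- s); rewrite mulrNN rs -E0 !mulr0 mulNr => /(_ ss erefl).
    by rewrite oppr_gt0 => /(lt_trans sg); rewrite ltxx.
  (* The step that cancels the residual at t. *)
  exists (E / (s * g t)); first exact: divr_gt0.
  suff -> : r t - E / (s * g t) * g t = 0 by rewrite normr0.
  have /andP[s_neq0 g_neq0] : (s != 0) && (g t != 0).
    by rewrite -negb_or -mulf_eq0 gt_eqF.
  have -> : E / (s * g t) * g t = E / s by field; rewrite s_neq0.
  by rewrite rs -[X in X / s]mul1r -ss; field.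
have /compact_near_coveringP cov := K_compact.
have : \forall d \near (0 : R)^'+, [set: K] `<=` (fun t => `|r t - d * g t| < E).
  apply: cov => t _; have [e e0 et] := pointwise t.
  near=> t' d.
  have et' : `|r t' - e * g t'| < E.
    near: t'; apply: (@cvgr_lt _ _ _ _ _ `|r t - e * g t|) => //.
    by apply: cvg_norm; apply: cvgB; [exact: cr|apply: cvgM; [exact: cvg_cst|exact: cg]].
  have d0 : 0 < d by near: d; exact: nbhs_right_gt.
  have de : d <= e by near: d; exact: nbhs_right_le.
  pose s := d / e; have dE : d = s * e by rewrite divfK// gt_eqF.
  have s0 : 0 < s by exact: divr_gt0.
  have s1 : s <= 1 by rewrite ler_pdivrMr// mul1r.
  clearbody s.
  have -> : r t' - d * g t' = (1 - s) * r t' + s * (r t' - e * g t').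
    by rewrite dE; ring.
  rewrite (le_lt_trans (ler_normD _ _))// !normrM (gtr0_norm s0) ger0_norm ?subr_ge0//.
  have : s * `|r t' - e * g t'| < s * E by rewrite ltr_pM2l.
  have : (1 - s) * `|r t'| <= (1 - s) * E by rewrite ler_wpM2l// subr_ge0.
  lra.
by move=> /filter_ex [d Hd]; exists d => t; exact: Hd.
Unshelve. all: by end_near. Qed.

Context {n : nat} {phi : 'I_n -> K -> R}.
Hypothesis phi_continuous : forall k, continuous (phi k).
Context {f : K -> R}.
Hypothesis f_continuous : continuous f.

Lemma continuous_lin_comb (c : 'I_n -> R) : continuous (lin_comb phi c).
Proof.
apply: continuous_sum => k t; apply: cvgM; first exact: cvg_cst.
exact: phi_continuous.
Qed.

Lemma continuous_residual (p : K -> R) : polynomials phi p -> continuous (p \- f).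
Proof.
move=> [c _ <-] t; apply: cvgB; last exact: f_continuous.
exact: continuous_lin_comb.
Qed.

(** The weights and signed points come from the first branch of [separation];
    in the second branch, the coefficients c define a descent direction for
    p. The sign is carried as a second coordinate, in [-1, 1], rather than
    computed from p - f, so that the zero residual needs no special case. *)
Lemma alternance_points (p : K -> R) : best_approximation phi f p ->
  exists (x : 'I_n.+1 -> K * R) (w : 'I_n.+1 -> R),
    [/\ forall i, (x i).2 * (x i).2 = 1,
        forall i, p (x i).1 - f (x i).1 = (x i).2 * uniform_norm (p \- f),
        forall i, 0 <= w i, \sum_i w i = 1
      & \sum_i w i *: ((x i).2 *: moment_vector phi (x i).1) = 0].
Proof.
move=> [pP pbest]; set E := uniform_norm _.
have cr := continuous_residual pP.
have rE t : `|p t - f t| <= E by exact: (le_uniform_norm t cr).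
pose X : set (K * R) := ([set: K] `*` `[-1, 1])
  `&` ([set x | x.2 * x.2 = 1] `&` [set x | p x.1 - f x.1 - x.2 * E = 0]).
have c2 : continuous (fun x : K * R => x.2) by move=> x; exact: cvg_snd.
have comp1 (F : K -> R) : continuous F -> continuous (fun x : K * R => F x.1).
  move=> cF x; apply: (@continuous_comp _ _ _ (fun x : K * R => x.1) F).
    exact: cvg_fst.
  exact: cF.
have cX : compact X.
  apply: compact_closedI.
    by apply: compact_setX => //; exact: segment_compact.
  apply: closedI; apply: closed_level_set => x.
    exact: (cvgM (c2 x) (c2 x)).
  apply: cvgB; first exact: (comp1 _ cr x).
  by apply: cvgM; [exact: c2|exact: cvg_cst].
have XP t s : s * s = 1 -> p t - f t = s * E -> X (t, s).
  move=> ss rs; do 2?split => //=; last by rewrite rs subrr.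
  rewrite in_itv/= -ler_norml.
  by rewrite -(@ler_pXn2r _ 2) ?nnegrE// expr1n real_normK ?num_real// expr2 ss.
have X0 : X !=set0.
  have [t tE _] := uniform_norm_max K_compact K_nonempty cr.
  have [r0|r0] := leP 0 (p t - f t).
    by exists (t, 1); apply: XP; rewrite ?mulr1// mul1r /E tE ger0_norm.
  exists (t, -1); apply: XP; first by rewrite mulrNN mulr1.
  by rewrite mulN1r /E tE ltr0_norm ?opprK.
pose h (x : K * R) := x.2 *: moment_vector phi x.1.
have ch k : continuous (fun x => h x k 0).
  have -> : (fun x => h x k 0) = (fun x : K * R => x.2 * phi k x.1).
    by apply/funext => x; rewrite !mxE.
  by move=> x; exact: (cvgM (c2 x) (comp1 _ (phi_continuous (k := k)) x)).
have [[x [w [Xx w0 w1 wh]]]|[c c_pos]] := separation cX X0 ch.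
  exists x, w; split => // i; have [_ [//=]] := Xx i.
  by move=> _ /eqP; rewrite subr_eq0 => /eqP.
have cposE t s : s * s = 1 -> p t - f t = s * E ->
    0 < s * lin_comb phi (fun k => c k 0) t.
  move=> ss rs; have := c_pos _ (XP _ _ ss rs); congr (0 < _).
  by rewrite /dot mulr_sumr; apply: eq_bigr => k _; rewrite !mxE /=; ring.
have [e eE] := kolmogorov_descent cr (@continuous_lin_comb _) rE cposE.
have [b _ bp] := pP.
have qP : polynomials phi (fun t => p t - e * lin_comb phi (fun k => c k 0) t).
  exists (fun k => b k - e * c k 0) => //; apply/funext => t.
  rewrite -bp /lin_comb mulr_sumr -sumrB; apply: eq_bigr => k _ /=; ring.
have := pbest _ qP; have [t -> _] := uniform_norm_max K_compact K_nonempty (continuous_residual qP).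
rewrite leNgt /= => /negP []; have := eE t; congr (`|_| < _) => /=; ring.
Qed.

(** Take p for which the space U of coefficient vectors that vanish at all
    extremal points of p can be chosen of largest dimension. For another best
    approximation q, the midpoint of p and q is again one, and its extremal
    points are extremal points of p where q = p. So the coefficients of q - p may
    be added to U for the midpoint, and by maximality they already belong to U: q
    and p agree at the extremal points of p. *)
Lemma generic_best_approximation :
  (exists p, best_approximation phi f p) ->
  exists2 p, best_approximation phi f p & forall q, best_approximation phi f q ->
    forall t, `|p t - f t| = uniform_norm (p \- f) -> q t = p t.
Proof.
move=> [p0 p0best].
pose annih (p : K -> R) (U : {vspace 'rV[R]_n}) := forall d, d \in U ->
  forall t, `|p t - f t| = uniform_norm (p \- f) -> lin_comb phi (d 0) t = 0.
pose P k := `[< exists p, exists U, [/\ best_approximation phi f p, annih p U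
  & \dim U = k] >].
have P0 : exists k, P k.
  exists 0; apply/asboolP; exists p0, 0%VS; split => //; last exact: dimv0.
  move=> d; rewrite memv0 => /eqP -> t _.
  by rewrite /lin_comb big1// => k _; rewrite mxE mul0r.
have Pbound k : P k -> (k <= \dim {:'rV[R]_n})%N.
  by move=> /asboolP [p [U [_ _ <-]]]; exact: dimvS (subvf _).
case: (ex_maxnP P0 Pbound) => k /asboolP [p [U [pbest pU Uk]]] kmax.
exists p => // q qbest t pt.
have [[pP pmin] [qP qmin]] := (pbest, qbest).
have qE : uniform_norm (q \- f) = uniform_norm (p \- f).
  by apply/eqP; rewrite eq_le pmin// qmin.
set E := uniform_norm (p \- f) in pt qE.
have pE s : `|p s - f s| <= E := le_uniform_norm s (continuous_residual pP).
have qEs s : `|q s - f s| <= E by rewrite -qE; exact: le_uniform_norm s (continuous_residual qP).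
have [[a _ ap] [b _ bq]] := (pP, qP).
pose m s := 2^-1 * (p s + q s).
have mP : polynomials phi m.
  exists (fun k => 2^-1 * (a k + b k)) => //; apply/funext => s.
  rewrite /m -ap -bq /lin_comb -big_split/= mulr_sumr.
  by apply: eq_bigr => i _; ring.
have mE s : `|m s - f s| <= E.
  have := pE s; have := qEs s; rewrite !ler_norml /m => /andP[? ?] /andP[? ?].
  by apply/andP; split; lra.
have mbest : best_approximation phi f m.
  split => // u uP; apply: le_trans (pmin _ uP).
  exact: uniform_norm_le (continuous_residual mP) mE.
have mEE : uniform_norm (m \- f) = E.
  apply/eqP; rewrite eq_le mbest.2//= pmin//.
have m_ext s : `|m s - f s| = E -> p s = q s /\ `|p s - f s| = E.
  have := pE s; have := qEs s; rewrite /m.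
  move: (p s) (q s) (f s) => x y z; rewrite !ler_norml => /andP[? ?] /andP[? ?] mz.
  have xy : x = y.
    by move: mz; case: (ger0P (2^-1 * (x + y) - z)) => _; lra.
  by split => //; rewrite -mz xy; congr `|_|; field.
pose e : 'rV[R]_n := \row_k (b k - a k).
have eE s : lin_comb phi (e 0) s = q s - p s.
  rewrite -ap -bq /lin_comb -sumrB; apply: eq_bigr => i _.
  by rewrite mxE mulrBl.
have mU : annih m (U + <[e]>)%VS.
  move=> _ /memv_addP [d dU [_ /vlineP [z ->] ->]] s; rewrite mEE => /m_ext [pq ps].
  have -> : lin_comb phi ((d + z *: e) 0) s =
      lin_comb phi (d 0) s + z * lin_comb phi (e 0) s.
    rewrite /lin_comb mulr_sumr -big_split; apply: eq_bigr => i _.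
    by rewrite !mxE /=; ring.
  by rewrite (pU _ dU _ ps) eE pq subrr mulr0 addr0.
have /kmax : P (\dim (U + <[e]>)).
  by apply/asboolP; exists m, (U + <[e]>)%VS; split.
rewrite -Uk => dimle.
have /eqP UE : U == (U + <[e]>)%VS by rewrite eqEdim addvSl.
have eU : e \in U by rewrite UE; apply: (subvP (addvSr U <[e]>)); exact: memv_line.
by apply/eqP; rewrite -subr_eq0 -eE; apply/eqP; exact: pU.
Qed.

End Approximation.

(** * The common alternance *)

Theorem theorem2 (R : realType) (K : metricType R)
    (K_compact : compact [set: K]) (K_nonempty : [set: K] !=set0)
    (n : nat) (phi : 'I_n -> K -> R)
    (phi_continuous : forall k, continuous (phi k))
    (phi_independent : linearly_independent phi)
    (f : K -> R) (f_continuous : continuous f) :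
  exists (m : nat) (tau : 'I_m -> K),
    (forall p : K -> R, best_approximation phi f p ->
       generalized_alternance phi f p tau) /\
    (forall i : 'I_m, forall p q : K -> R,
       best_approximation phi f p -> best_approximation phi f q ->
       p (tau i) = q (tau i)).
Proof.
have [ex_best|no_best] := pselect (exists p, best_approximation phi f p); last first.
  have [t0 _] := K_nonempty.
  by exists 0%N, (fun=> t0); split=> [p pb|[]//]; case: no_best; exists p.
have [p pbest pgen] := generic_best_approximation K_compact K_nonempty
  phi_continuous f_continuous ex_best.
have [x [w [ss rs w0 w1 wu]]] := alternance_points K_compact K_nonempty
  phi_continuous f_continuous pbest.
have normE q : best_approximation phi f q -> uniform_norm (q \- f) = uniform_norm (p \- f).
  by move=> qbest; apply/eqP; rewrite eq_le qbest.2 ?pbest.2//; case: pbest; case: qbest.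
have sign i : (x i).2 = -1 \/ (x i).2 = 1.
  have /eqP := ss i; rewrite -expr2 sqrf_eq1 => /orP[] /eqP ->; by [right|left].
have agree q i : best_approximation phi f q -> q (x i).1 = p (x i).1.
  move=> qbest; apply: pgen => //; rewrite rs normrM.
  have -> : `|(x i).2| = 1 by case: (sign i) => ->; rewrite ?normrN normr1.
  have [t -> _] := uniform_norm_max K_compact K_nonempty
    (continuous_residual phi_continuous f_continuous pbest.1).
  by rewrite mul1r normr_id.
exists n.+1, (fun i => (x i).1); split; last first.
  by move=> i q q' qbest q'best; rewrite !agree.
move=> q qbest; split; first by rewrite ltnSn.
exists (fun i => (x i).2); split => // [i|]; first by rewrite agree// normE.
by rewrite -wu; apply: convex_hull_sum => // i; exists i.
Qed.
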